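(* Let $\mathcal{X}$ be a finite set of $d\times d$ Hermitian matrices and $L\in\mathbb{R}$ such that $\lambda_{\max}(X)\le L$ for all $X\in\mathcal{X}$. Let $1\le n\le|\mathcal{X}|$, and sample two finite sequences $(X_k)_{k=1,\dots,n}$ and $(Y_k)_{k=1,\dots,n}$ uniformly at random from $\mathcal{X}$, respectively with and without replacement. Assume that $\mathbb{E}X_k=0$ for all $k$. Put $S_X:=\sum_{k=1}^nX_k$, $S_Y:=\sum_{k=1}^nY_k$, and $$v(S_X):=\big\|\mathbb{E}S_X^2\big\|=\Big\|\sum_{k=1}^n\mathbb{E}X_k^2\Big\|=\lambda_{\max}\Big(\sum_{k=1}^n\mathbb{E}X_k^2\Big).$$ Then $$\mathbb{E}\,\lambda_{\max}(S_Y)\le\sqrt{2\,v(S_X)\log d}+\frac13L\log d.$$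
   Context: $\lambda_{\max}$ denotes the largest eigenvalue and $\|\cdot\|$ the spectral norm. Sampling with replacement means that $X_1,\dots,X_n$ are independent and each uniform on $\mathcal{X}$; sampling without replacement means that $(Y_1,\dots,Y_n)$ is uniform over ordered $n$-tuples of distinct elements of $\mathcal{X}$. $\log$ is the natural logarithm. *)

(* Defs.v *)
From HB Require Import structures.
From mathcomp Require Export all_boot all_order all_algebra finmap.
From mathcomp Require Export sesquilinear spectral complex.
From mathcomp Require Export all_classical all_reals all_analysis.

Set Implicit Arguments.
Unset Strict Implicit.
Unset Printing Implicit Defensive.

Import Order.TTheory GRing.Theory Num.Theory.
Local Open Scope classical_set_scope.
Local Open Scope ring_scope.
Local Open Scope complex_scope.
Local Open Scope sesquilinear_scope.

Section Matrices.
Context {R : realType} {d : nat}.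

(* The set of real eigenvalues is finite, and for Hermitian A with d > 0 it is
   nonempty and contains every eigenvalue, so sup is then a maximum. *)
Definition lambda_max (A : 'M[R[i]]_d) : R :=
  sup [set x : R | eigenvalue A x%:C].

(* The largest singular value. *)
Definition spectral_norm (A : 'M[R[i]]_d) : R :=
  Num.sqrt (lambda_max (A^t* *m A)).

End Matrices.

Section Sampling.
Context {dO : measure_display} {Omega : measurableType dO} {R : realType}.
Variable P : probability Omega R.

(* Entrywise expectation.  fine sends infinite values to 0, which matters only
   for entries that are not integrable; finitely valued Z have none. *)
Definition mexpectation (d : nat) (Z : Omega -> 'M[R[i]]_d) : 'M[R[i]]_d :=
  \matrix_(i, j) (fine ('E_P[fun w => complex.Re (Z w i j)])
                  +i* fine ('E_P[fun w => complex.Im (Z w i j)])).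

(* Measurability with respect to the discrete sigma-algebra on the finite type
   U is included, as U carries no measurableType structure here. *)
Definition uniform_on (U : finType) (D : {set U}) (Z : Omega -> U) : Prop :=
  forall u : U, measurable (Z @^-1` [set u]) /\
    P (Z @^-1` [set u]) = (if u \in D then (#|D|%:R^-1)%:E else 0%E).

(* Product rule over every finite subfamily; the family is itself finite. *)
Definition mutually_independent (I U : finType) (Z : I -> Omega -> U) : Prop :=
  forall (J : {set I}) (B : I -> set U),
    P (\bigcap_(k in [set` J]) (Z k @^-1` B k)) =
    (\prod_(k in J) P (Z k @^-1` B k))%E.

Definition with_replacement (n : nat) (U : finType)
    (Z : 'I_n -> Omega -> U) : Prop :=
  mutually_independent Z /\ forall k, uniform_on [set: U]%SET (Z k).

Definition without_replacement (n : nat) (U : finType)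
    (Z : 'I_n -> Omega -> U) : Prop :=
  uniform_on [set t : {ffun 'I_n -> U} | injectiveb t]%SET
    (fun w => [ffun k => Z k w]).

End Sampling.

(* Main.v *)
Require Import Defs.
From mathcomp Require Import fingroup perm action primitive_action alt ring lra.

(* Hoeffding's comparison reduces sampling without replacement to sampling with
   replacement: every map s from {1,..,n} to the population factors as an injection u
   after a self-map p of {1,..,n}; averaging over the rotations of {1,..,n} replaces
   sum_k F (u (p k)) by sum_k F (u k), so convexity of lambda_max gives the inequality
   after averaging over all permutations of the population.

   With replacement the summands are identically distributed, so the
   Ahlswede-Winter argument loses nothing against Lieb's theorem.  With
   e^(t S) replaced by (1 + t S / m)^m, m = 2^k, it is:
     tr (1 + t (S + X) / m)^m <= tr ((1 + t S / m)^m (1 + t X / m)^m) + O(1/m)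
   by a Golden-Thompson inequality for powers, and E (1 + t X / m)^m is at most
   1 + g E X^2 with g = t^2 / (2 (1 - t L / 3)), whence E tr (1 + t S_n / m)^m is
   at most d exp (g v) + O(1/m).  Jensen's inequality, in the form of a tangent
   line to exp, turns this into t E lambda_max S_n <= ln d + g v, and
   1/t = s + L/3 with s optimal gives the bound. *)

Set Implicit Arguments.
Unset Strict Implicit.
Unset Printing Implicit Defensive.
Import Order.TTheory GRing.Theory Num.Theory.
Local Open Scope ring_scope.
Local Open Scope sesquilinear_scope.

(** * A Golden-Thompson inequality for powers *)

Section TraceInequalities.
Context {C : numClosedFieldType} {d : nat}.
Implicit Types (A B P Q : 'M[C]_d) (f : nat -> 'M[C]_d) (b : C).

Lemma mxringM A B : A * B = A *m B. Proof. by []. Qed.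

Lemma adjmxM A B : (A * B)^t* = B^t* * A^t*.
Proof. by rewrite !mxringM trmx_mul map_mxM. Qed.

Lemma adjmxD A B : (A + B)^t* = A^t* + B^t*.
Proof. by rewrite linearD map_mxD. Qed.

Lemma adjmx_sum (I : finType) (F : I -> 'M[C]_d) :
  (\sum_i F i)^t* = \sum_i (F i)^t*.
Proof. by apply: (big_morph (fun A => A^t*) adjmxD); rewrite trmx0 map_mx0. Qed.

Lemma adjmxZ a A : (a *: A)^t* = a^* *: A^t*.
Proof. by apply/matrixP=> i j; rewrite !mxE rmorphM. Qed.

Lemma adjmxX A n : (A ^+ n)^t* = (A^t*) ^+ n.
Proof.
elim: n => [|n IHn]; first by rewrite !expr0 trmx1 map_mx1.
by rewrite exprS adjmxM IHn exprSr.
Qed.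

Lemma mxtraceMC A B : \tr (A * B) = \tr (B * A).
Proof. by rewrite !mxringM mxtrace_mulC. Qed.

Lemma mxtrace_mulXC A B n : \tr ((A * B) ^+ n) = \tr ((B * A) ^+ n).
Proof.
case: n => [|n]; first by rewrite !expr0.
suff -> : (A * B) ^+ n.+1 = A * ((B * A) ^+ n * B).
  by rewrite mxtraceMC -mulrA -exprSr.
elim: n => [|n IHn]; first by rewrite expr1 expr0 mul1r.
by rewrite exprS IHn [in RHS]exprS !mulrA.
Qed.

Lemma mxtraceMadj A : \tr (A * A^t*) = \sum_i \sum_j `|A i j| ^+ 2.
Proof.
rewrite mxringM; apply: eq_bigr => i _; rewrite mxE.
by apply: eq_bigr => j _; rewrite !mxE -normCK.
Qed.

Lemma prod_ord_double f n :
  \prod_(i < n.*2) f i = \prod_(i < n) (f i.*2 * f i.*2.+1).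
Proof.
elim: n => [|n IHn]; first by rewrite !big_ord0.
by rewrite doubleS !big_ord_recr /= IHn mulrA.
Qed.

(** Cauchy-Schwarz for the Hilbert-Schmidt product, through [2 x y <= x^2 + y^2] on each pair of
    entries; a common bound [b] avoids square roots. *)
Lemma norm_mxtraceM_le A B b :
  \tr (A * A^t*) <= b -> \tr (B * B^t*) <= b -> `|\tr (A * B)| <= b.
Proof.
rewrite mxtraceMadj => leA leB.
have leB' : \sum_i \sum_j `|B j i| ^+ 2 <= b.
  by rewrite exchange_big -mxtraceMadj.
rewrite -(ler_pM2r (ltr0Sn C 1)) mulr_natr mulr2n [b * _]mulr_natr mulr2n.
apply: le_trans (lerD leA leB').
rewrite mxringM -big_split /=.
have h : `|\tr (A *m B)| <= \sum_i \sum_j `|A i j| * `|B j i|.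
  apply: le_trans (ler_norm_sum _ _ _) _; apply: ler_sum => i _.
  rewrite mxE; apply: le_trans (ler_norm_sum _ _ _) _.
  by apply: ler_sum => j _; rewrite normrM.
apply: le_trans (lerD h h) _; rewrite -big_split; apply: ler_sum => i _ /=.
rewrite -!big_split; apply: ler_sum => j _ /=.
have := real_leif_mean_square (normr_real (A i j)) (normr_real (B j i)).
by case=> + _; rewrite ler_pdivlMr ?ltr0Sn// mulr_natr mulr2n.
Qed.

(* The induction pairs consecutive factors: for [B = F G] the trace of
   [(B B^t* )^(2^k)] is, by cyclicity, the trace of an alternating product of
   [F^t* F] and [G G^t*]. *)
Lemma norm_mxtrace_prod_le k f b :
  (forall i, `|\tr ((f i * (f i)^t*) ^+ (2 ^ k))| <= b) ->
  `|\tr (\prod_(i < 2 ^ k.+1) f i)| <= b.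
Proof.
elim: k f => [|k IHk] f le_b.
  rewrite expn1 !big_ord_recr big_ord0 /= mul1r.
  have le_b' i : \tr (f i * (f i)^t*) <= b.
    apply: le_trans (le_b i); rewrite expr1 real_ler_norm// mxtraceMadj.
    by do 2![rewrite rpred_sum// => ? _]; rewrite rpredX ?normr_real.
  exact: norm_mxtraceM_le.
rewrite expnS mul2n prod_ord_double.
apply: (IHk (fun i => f i.*2 * f i.*2.+1)) => i.
set F := f i.*2; set G := f i.*2.+1.
have -> : \tr (((F * G) * (F * G)^t*) ^+ (2 ^ k)) =
          \tr ((F^t* * F * (G * G^t*)) ^+ (2 ^ k)).
  by rewrite adjmxM !mulrA [in LHS]mxtrace_mulXC !mulrA.
pose h j := if odd j then G * G^t* else F^t* * F.
have -> : (F^t* * F * (G * G^t*)) ^+ (2 ^ k) = \prod_(j < 2 ^ k.+1) h j.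
  rewrite expnS mul2n prod_ord_double /h.
  under eq_bigr do rewrite /= odd_double /=.
  by rewrite prodr_const cardT size_enum_ord.
apply: IHk => j; rewrite /h.
(* Each [h j] is self-adjoint, so its product with its adjoint is a square, whose power [2 ^ k] is
   the power [2 ^ k.+1] of a Gram matrix: up to cyclicity this is the hypothesis. *)
case: ifP => _; rewrite adjmxM trmxCK -expr2 -exprM -expnS; first exact: le_b.
by rewrite mxtrace_mulXC; exact: le_b.
Qed.

(** Induction with the squares of [P] and [Q]: the product bound with all factors equal to [P * Q]
    leaves the trace of a power of [P Q Q P], by cyclicity that of the same power of
    [P ^+ 2 * Q ^+ 2]. *)
Lemma golden_thompson_pow P Q k : P^t* = P -> Q^t* = Q ->
  `|\tr ((P * Q) ^+ (2 ^ k))| <= `|\tr (P ^+ (2 ^ k) * Q ^+ (2 ^ k))|.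
Proof.
elim: k P Q => [|k IHk] P Q PE QE; first by rewrite !expr1.
rewrite !expnS ![in leRHS]exprM.
apply: le_trans (IHk _ _ _ _); last 2 first.
- by rewrite adjmxX PE.
- by rewrite adjmxX QE.
rewrite -expnS -[in leLHS](card_ord (2 ^ k.+1)) -prodr_const.
apply: (norm_mxtrace_prod_le (f := fun=> P * Q)) => _.
by rewrite adjmxM PE QE !mulrA [in leLHS]mxtrace_mulXC !mulrA -expr2 -mulrA -expr2.
Qed.

End TraceInequalities.

(** * Positive semidefinite and diagonalized matrices *)

Section PositiveSemidefinite.
Context {C : numClosedFieldType} {d : nat}.
Implicit Types (A B U : 'M[C]_d) (x : 'rV[C]_d) (f g : 'I_d -> C).

Definition qform A x : C := (x *m A *m x^t*) 0 0.

Definition psdmx A := forall x, 0 <= qform A x.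

Lemma qformD A B x : qform (A + B) x = qform A x + qform B x.
Proof. by rewrite /qform mulmxDr mulmxDl mxE. Qed.

Lemma qformZ a A x : qform (a *: A) x = a * qform A x.
Proof. by rewrite /qform -scalemxAr -scalemxAl mxE. Qed.

Lemma psdmxD A B : psdmx A -> psdmx B -> psdmx (A + B).
Proof. by move=> Apsd Bpsd x; rewrite qformD addr_ge0. Qed.

Lemma psdmxZ a A : 0 <= a -> psdmx A -> psdmx (a *: A).
Proof. by move=> a_ge0 Apsd x; rewrite qformZ mulr_ge0. Qed.

Lemma psdmx_sum (I : finType) (F : I -> 'M[C]_d) :
  (forall i, psdmx (F i)) -> psdmx (\sum_i F i).
Proof.
move=> Fpsd; apply: (big_ind psdmx) => [x||//]; last exact: psdmxD.
by rewrite /qform mulmx0 mul0mx mxE.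
Qed.

Lemma qform1 x : qform 1 x = \sum_i `|x 0 i| ^+ 2.
Proof.
rewrite /qform mulmx1 mxE; apply: eq_bigr => i _.
by rewrite !mxE normCK.
Qed.

Lemma qform_conj A B x : qform (B *m A *m B^t*) x = qform A (x *m B).
Proof. by rewrite /qform trmx_mul map_mxM !mulmxA. Qed.

Lemma psdmx_gram A : psdmx (A * A^t*).
Proof.
move=> x; rewrite mxringM -[A in A *m _]mulmx1 qform_conj qform1.
by apply: sumr_ge0 => i _; rewrite exprn_ge0.
Qed.

(** By cyclicity the trace is the sum of the values of the quadratic form of [B] at the rows of the
    adjoint of [A]. *)
Lemma mxtrace_gramM_ge0 A B : psdmx B -> 0 <= \tr (A * A^t* * B).
Proof.
move=> Bpsd; rewrite -mulrA mxtraceMC; apply: sumr_ge0 => i _.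
have := Bpsd (row i (A^t*)); rewrite /qform -row_mul !mxE.
congr (_ <= _); apply: eq_bigr => j _.
by rewrite !mxE conjCK.
Qed.

(* Locked because unification would otherwise unfold it against ring operations. *)
Definition diagin U f : 'M[C]_d := locked (U^t* *m diag_mx (\row_i f i) *m U).

Lemma eq_diagin U f g : f =1 g -> diagin U f = diagin U g.
Proof.
by move=> fg; rewrite /diagin -!lock; congr (_ *m diag_mx _ *m _); apply/rowP=> i; rewrite !mxE.
Qed.

Lemma diaginD U f g : diagin U f + diagin U g = diagin U (fun i => f i + g i).
Proof.
rewrite /diagin -!lock -mulmxDl -mulmxDr -linearD; congr (_ *m diag_mx _ *m _).
by apply/rowP=> i; rewrite !mxE.
Qed.

Lemma diaginZ U a f : a *: diagin U f = diagin U (fun i => a * f i).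
Proof.
rewrite /diagin -!lock scalemxAl scalemxAr -linearZ; congr (_ *m diag_mx _ *m _).
by apply/rowP=> i; rewrite !mxE.
Qed.

Lemma diaginB U f g : diagin U f - diagin U g = diagin U (fun i => f i - g i).
Proof.
rewrite -scaleN1r diaginZ diaginD; apply: eq_diagin => i.
by rewrite mulN1r.
Qed.

Section Unitary.
Variable U : 'M[C]_d.
Hypothesis Uunitary : U \is unitarymx.

Lemma adjmx_unitaryK : U^t* *m U = 1%:M.
Proof. by apply: mulmx1C; exact/unitarymxP. Qed.

Lemma diagin_const a : diagin U (fun=> a) = a%:M.
Proof.
rewrite /diagin -!lock (_ : \row_(i < d) a = const_mx a); last by apply/rowP=> i; rewrite !mxE.
rewrite diag_const_mx mul_mx_scalar.
by rewrite -scalemxAl adjmx_unitaryK scalemx1.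
Qed.

Lemma diagin1 : diagin U (fun=> 1) = 1.
Proof. exact: diagin_const. Qed.

Lemma diaginM f g : diagin U f * diagin U g = diagin U (fun i => f i * g i).
Proof.
rewrite mxringM /diagin -!lock !mulmxA mulmxtVK // -[_ *m diag_mx _ *m diag_mx _]mulmxA.
rewrite mulmx_diag; congr (_ *m diag_mx _ *m _).
by apply/rowP=> i; rewrite !mxE.
Qed.

Lemma diaginX f n : diagin U f ^+ n = diagin U (fun i => f i ^+ n).
Proof.
elim: n => [|n IHn].
  by rewrite expr0 -diagin1; apply: eq_diagin => i; rewrite expr0.
by rewrite exprS IHn diaginM; apply: eq_diagin => i; rewrite exprS.
Qed.

Lemma mxtrace_diagin f : \tr (diagin U f) = \sum_i f i.
Proof.
rewrite /diagin -!lock mxtrace_mulC mulmxA (unitarymxP Uunitary) mul1mx mxtrace_diag.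
by apply: eq_bigr => i _; rewrite !mxE.
Qed.

Lemma qform_diagin f x :
  qform (diagin U f) x = \sum_i f i * `|(x *m U^t*) 0 i| ^+ 2.
Proof.
rewrite /diagin -!lock -[U in _ *m U]trmxCK qform_conj /qform mul_mx_diag mxE.
by apply: eq_bigr => i _; rewrite !mxE normCK mulrAC mulrC.
Qed.

Lemma psdmx_diagin f : (forall i, 0 <= f i) -> psdmx (diagin U f).
Proof.
move=> f_ge0 x; rewrite qform_diagin; apply: sumr_ge0 => i _.
by rewrite mulr_ge0 ?exprn_ge0.
Qed.

Lemma qform_diagin_row f i : qform (diagin U f) (row i U) = f i.
Proof.
rewrite qform_diagin -row_mul (unitarymxP Uunitary) (bigD1 i)//= big1 => [|j ne_ji].
  by rewrite !mxE eqxx normr1 expr1n mulr1 addr0.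
by rewrite !mxE eq_sym (negPf ne_ji) normr0 expr0n mulr0.
Qed.

Lemma eigenvalue_diagin f a : eigenvalue (diagin U f) a = [exists i, a == f i].
Proof.
apply/eigenvalueP/existsP => [[v vA v_neq0]|[i /eqP->]]; last first.
  exists (row i U).
    rewrite /diagin -!lock !mulmxA -row_mul (unitarymxP Uunitary) row1.
    rewrite -rowE row_diag_mx !mxE -scalemxAl -rowE //.
  apply: contraTneq isT => rowU0; have := congr1 (row i) (unitarymxP Uunitary).
  rewrite row_mul rowU0 mul0mx => /rowP/(_ i)/eqP.
  by rewrite !mxE eqxx eq_sym oner_eq0.
have [y vU] : exists y, v *m U^t* = y by exists (v *m U^t*).
have yE : v = y *m U by rewrite -vU -mulmxA adjmx_unitaryK mulmx1.
have /rV0Pn[i yi_neq0] : y != 0.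
  by apply: contraNneq v_neq0 => y0; rewrite yE y0 mul0mx.
exists i; have := congr1 (mulmx^~ (U^t*)) vA.
rewrite /diagin -!lock !mulmxA vU mulmxtVK // -scalemxAl vU => /rowP/(_ i).
rewrite mul_mx_diag !mxE [a * _]mulrC => yia.
by apply/eqP; apply: (mulfI yi_neq0); rewrite yia.
Qed.

End Unitary.

Lemma hermitian_diagin A : A^t* = A ->
  exists U f, [/\ U \is unitarymx, forall i, f i \is Num.real & A = diagin U f].
Proof.
move=> Aherm; have hA : A \is hermsymmx.
  by apply/is_hermitianmxP; rewrite expr0 scale1r; apply/esym.
have U_unitary := spectral_unitarymx A.
exists (spectralmx A), (fun i => spectral_diag A 0 i); split=> //.
  by move=> i; exact: (mxOverP (hermitian_spectral_diag_real hA)).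
rewrite [LHS](orthomx_spectralP (hermitian_normalmx hA)) invmx_unitary // /diagin -lock.
by congr (_ *m diag_mx _ *m _); apply/rowP=> i; rewrite mxE.
Qed.

Lemma hermsymmxE A : A \is hermsymmx -> A^t* = A.
Proof. by move/is_hermitianmxP; rewrite expr0 scale1r => <-. Qed.

End PositiveSemidefinite.

(** * The product formula *)

Local Open Scope complex_scope.
Local Open Scope sesquilinear_scope.

(** * Bounds on absolute row sums *)

Section RowSumNorm.
Context {C : numClosedFieldType} {d : nat}.
Implicit Types (A B X Y : 'M[C]_d) (a b r : C).

Definition rowsum_le A a := forall i, \sum_j `|A i j| <= a.

Lemma rowsum_le_ex A : exists2 a, 0 <= a & rowsum_le A a.
Proof.
exists (\sum_i \sum_j `|A i j|) => [|i].
  by do 2![apply: sumr_ge0 => ? _].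
rewrite [leRHS](bigD1 i)//= lerDl; apply: sumr_ge0 => k _.
exact: sumr_ge0.
Qed.

Lemma rowsum_leW A a b : a <= b -> rowsum_le A a -> rowsum_le A b.
Proof. by move=> ab Aa i; apply: le_trans ab. Qed.

Lemma rowsum_le1 : rowsum_le 1 1.
Proof.
move=> i; rewrite (bigD1 i)//= big1 => [|j ne_ji]; rewrite mxE.
  by rewrite eqxx normr1 addr0.
by rewrite eq_sym (negPf ne_ji) normr0.
Qed.

Lemma rowsum_leD A B a b :
  rowsum_le A a -> rowsum_le B b -> rowsum_le (A + B) (a + b).
Proof.
move=> Aa Bb i; apply: le_trans (lerD (Aa i) (Bb i)).
rewrite -big_split; apply: ler_sum => j _ /=.
by rewrite mxE ler_normD.
Qed.

Lemma rowsum_leM A B a b : 0 <= b ->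
  rowsum_le A a -> rowsum_le B b -> rowsum_le (A * B) (a * b).
Proof.
move=> b_ge0 Aa Bb i.
apply: (@le_trans _ _ (\sum_j \sum_k `|A i k| * `|B k j|)).
  apply: ler_sum => j _; rewrite mxE; apply: le_trans (ler_norm_sum _ _ _) _.
  by apply: ler_sum => k _; rewrite normrM.
rewrite exchange_big /=; apply: le_trans (ler_wpM2r b_ge0 (Aa i)).
rewrite mulr_suml; apply: ler_sum => k _.
by rewrite -mulr_sumr ler_wpM2l.
Qed.

Lemma rowsum_leZ z A a : rowsum_le A a -> rowsum_le (z *: A) (`|z| * a).
Proof.
move=> Aa i; apply: le_trans (ler_wpM2l (normr_ge0 z) (Aa i)).
by rewrite mulr_sumr; apply: ler_sum => j _; rewrite mxE normrM.
Qed.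

Lemma rowsum_leX A a n : 0 <= a -> rowsum_le A a -> rowsum_le (A ^+ n) (a ^+ n).
Proof.
move=> a_ge0 Aa; elim: n => [|n IHn]; first exact: rowsum_le1.
by rewrite !exprS; apply: rowsum_leM; rewrite ?exprn_ge0.
Qed.

(** Telescoping of the difference of powers; [r >= 1] lets the exponent [n] replace the sharper
    [n - 1]. *)
Lemma rowsum_le_exprB X Y r e n : 1 <= r -> 0 <= e ->
  rowsum_le X r -> rowsum_le Y r -> rowsum_le (X - Y) e ->
  rowsum_le (X ^+ n - Y ^+ n) (n%:R * e * r ^+ n).
Proof.
move=> r_ge1 e_ge0 Xr Yr XYe; have r_ge0 : 0 <= r := le_trans ler01 r_ge1.
elim: n => [|n IHn]; first by rewrite subrr !mul0r => i; rewrite big1// => j _; rewrite mxE normr0.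
have -> : X ^+ n.+1 - Y ^+ n.+1 = X * (X ^+ n - Y ^+ n) + (X - Y) * Y ^+ n.
  by rewrite mulrBr mulrBl -!exprS addrA subrK.
apply: rowsum_leW (rowsum_leD (rowsum_leM _ Xr IHn) (rowsum_leM _ XYe (rowsum_leX n _ Yr))) => //;
  rewrite ?mulr_ge0 ?exprn_ge0//.
rewrite -natr1 !mulrDl mul1r mulrCA -exprS lerD2l.
by rewrite exprS ler_wpM2l// ler_peMl// exprn_ge0.
Qed.

Lemma norm_mxtrace_rowsum A a : rowsum_le A a -> `|\tr A| <= d%:R * a.
Proof.
move=> Aa; apply: le_trans (ler_norm_sum _ _ _) _.
rewrite mulr_natl -[d in leRHS]card_ord -sumr_const; apply: ler_sum => i _.
apply: le_trans (Aa i); rewrite (bigD1 i)//= lerDl.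
by apply: sumr_ge0.
Qed.

End RowSumNorm.

Section ProductFormula.
Context {R : realType} {d : nat}.
Local Notation C := R[i].
Implicit Types (A B : 'M[C]_d).

(** The two bases differ by [A B / m^2], so their [m]-th powers differ by [O(1/m)]: the row sums of
    the powers stay below [exp (2 r)], with [r] a common bound for [A] and [B]. *)
Lemma mxtrace_lie_product A B : exists2 K : R, 0 <= K &
  forall m, (0 < m)%N ->
  `|\tr ((1 + m%:R^-1 *: (A + B)) ^+ m) -
    \tr (((1 + m%:R^-1 *: A) * (1 + m%:R^-1 *: B)) ^+ m)| <= (K / m%:R)%:C.
Proof.
have [a a_ge0 Aa] := rowsum_le_ex A; have [b b_ge0 Bb] := rowsum_le_ex B.
have [r rE] : exists r : R, a + b = r%:C.
  by exists (complex.Re (a + b)); rewrite RRe_real// ger0_real// addr_ge0.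
have r_ge0 : 0 <= r by rewrite -ler0c -rE addr_ge0.
have Ar : rowsum_le A r%:C by apply: rowsum_leW Aa; rewrite -rE lerDl.
have Br : rowsum_le B r%:C by apply: rowsum_leW Bb; rewrite -rE lerDr.
exists (d%:R * (r ^+ 2 * expR (r + r))) => [|m m_gt0].
  by rewrite !mulr_ge0 ?exprn_ge0 ?expR_ge0.
have mC : m%:R^-1 = (m%:R^-1)%:C :> C by rewrite fmorphV rmorph_nat.
have m_neq0 : m%:R != 0 :> R by rewrite pnatr_eq0 -lt0n.
have step (D : 'M[C]_d) (s : R) : rowsum_le D s%:C ->
    rowsum_le (1 + m%:R^-1 *: D) (1 + m%:R^-1 * s)%:C.
  move=> Ds; rewrite rmorphD rmorphM rmorph1 /=; apply: rowsum_leD (rowsum_le1) _.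
  rewrite -mC -[X in rowsum_le _ (X * _)](@ger0_norm C) ?invr_ge0 ?ler0n//.
  exact: rowsum_leZ.
pose q := (1 + m%:R^-1 * r) * (1 + m%:R^-1 * r).
have q1 : 1 <= 1 + m%:R^-1 * r by rewrite lerDl mulr_ge0 ?invr_ge0.
have q_ge1 : 1 <= q by rewrite -[1]mulr1 ler_pM.
have q0 : 0 <= 1 + m%:R^-1 * r := le_trans ler01 q1.
have qm : q ^+ m <= expR (r + r).
  rewrite exprMn expRD.
  have h : (1 + m%:R^-1 * r) ^+ m <= expR r.
    rewrite -[r in leRHS](mulVKf m_neq0) expRM_natl.
    by rewrite lerXn2r ?nnegrE ?expR_ge0// expR_ge1Dx.
  by rewrite ler_pM ?exprn_ge0.
rewrite -raddfB /=; apply: le_trans (norm_mxtrace_rowsum _) _.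
  apply: (@rowsum_le_exprB _ _ _ _ q%:C ((m%:R^-1 * r) * (m%:R^-1 * r))%:C).
  - by rewrite -[1]/(1%:C) lecR.
  - by rewrite ler0c !mulr_ge0 ?invr_ge0.
  - apply: rowsum_leW (step _ (r + r) _).
      rewrite lecR /q mulrDl mul1r [_ * (_ + _)]mulrDr mulr1 mulrDr !addrA lerDl.
      by rewrite !mulr_ge0 ?invr_ge0.
    by rewrite rmorphD; exact: rowsum_leD.
  - by rewrite rmorphM; apply: rowsum_leM (step _ _ Ar) (step _ _ Br); rewrite ler0c.
  set A' := m%:R^-1 *: A; set B' := m%:R^-1 *: B.
  have -> : 1 + m%:R^-1 *: (A + B) - (1 + A') * (1 + B') = -1 *: (A' * B').
    rewrite scalerDr -/A' -/B' mulrDl mul1r mulrDr mulr1 scaleN1r.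
    by rewrite [1 + B' + _]addrA [1 + B' + A']addrAC -[1 + A' + B']addrA opprD [LHS]addrA subrr add0r.
  have stepZ (D : 'M[C]_d) : rowsum_le D r%:C -> rowsum_le (m%:R^-1 *: D) (m%:R^-1 * r)%:C.
    rewrite rmorphM /= -mC -[X in rowsum_le _ (X * _)](@ger0_norm C) ?invr_ge0 ?ler0n//.
    exact: rowsum_leZ.
  rewrite rmorphM /= -[X in rowsum_le _ X]mul1r -[X in X * (_ * _)](normrN1 C).
  apply: rowsum_leZ; apply: rowsum_leM (stepZ _ Ar) (stepZ _ Br).
  by rewrite ler0c mulr_ge0 ?invr_ge0.
have -> : d%:R * (m%:R * ((m%:R^-1 * r) * (m%:R^-1 * r))%:C * q%:C ^+ m) =
    (d%:R * (r ^+ 2 * q ^+ m) / m%:R)%:C.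
  rewrite -rmorphXn -!(rmorph_nat (real_complex R)) -!rmorphM; congr _%:C.
  by rewrite /=; field.
rewrite lecR ler_pM2r ?invr_gt0 ?ltr0n//.
by rewrite ler_wpM2l// ler_wpM2l// exprn_ge0.
Qed.

End ProductFormula.

(** * The largest eigenvalue *)

Section LambdaMax.
Context {R : realType} {d : nat}.
Hypothesis d_gt0 : (0 < d)%N.
Implicit Types (A B : 'M[R[i]]_d) (c t : R).

Lemma realCM c t : (c * t)%:C = c%:C * t%:C. Proof. exact: rmorphM. Qed.
Lemma realCD c t : (c + t)%:C = c%:C + t%:C. Proof. exact: rmorphD. Qed.
Lemma realCB c t : (c - t)%:C = c%:C - t%:C. Proof. exact: rmorphB. Qed.
Lemma realCX c n : (c ^+ n)%:C = c%:C ^+ n. Proof. exact: rmorphXn. Qed.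
Lemma realC_nat n : (n%:R : R)%:C = n%:R. Proof. exact: rmorph_nat. Qed.
Lemma realC_sum (I : finType) (F : I -> R) : (\sum_i F i)%:C = \sum_i (F i)%:C.
Proof. exact: rmorph_sum. Qed.

Lemma lambda_max_diagin U (l : 'I_d -> R) : U \is unitarymx ->
  exists2 i0, lambda_max (diagin U (fun i => (l i)%:C)) = l i0 &
    forall i, l i <= l i0.
Proof.
move=> Uunitary.
have [i0 _ l_max] := @arg_maxP _ R 'I_d (Ordinal d_gt0) xpredT l isT.
exists i0 => [|i]; last exact: l_max.
rewrite /lambda_max; set E := [set _ | _]%classic.
have l0E : E (l i0).
  by rewrite /E /= eigenvalue_diagin//; apply/existsP; exists i0.
apply/eqP; rewrite eq_le; apply/andP; split.
  apply: ge_sup; first by exists (l i0).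
  move=> x /=; rewrite /E /= eigenvalue_diagin// => /existsP[i /eqP/complexI->].
  exact: l_max.
apply: ub_le_sup => //; exists (l i0) => x.
rewrite /E /= eigenvalue_diagin// => /existsP[i /eqP/complexI->].
exact: l_max.
Qed.

Lemma hermitian_lambda_max A : A^t* = A -> exists U (l : 'I_d -> R) i0,
  [/\ U \is unitarymx, A = diagin U (fun i => (l i)%:C),
      lambda_max A = l i0 & forall i, l i <= l i0].
Proof.
move=> /hermitian_diagin[U [f [Uunitary f_real ->]]].
have fE : f =1 (fun i => (complex.Re (f i))%:C) by move=> i; rewrite RRe_real.
rewrite (eq_diagin _ fE).
have [i0 lE l_max] := lambda_max_diagin (fun i => complex.Re (f i)) Uunitary.
by exists U, (fun i => complex.Re (f i)), i0.
Qed.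

Lemma diagin_subr U (l : 'I_d -> R) c : U \is unitarymx ->
  c%:C%:M - diagin U (fun i => (l i)%:C) = diagin U (fun i => (c - l i)%:C).
Proof.
move=> Uunitary; rewrite -(diagin_const Uunitary) diaginB.
by apply: eq_diagin => i; rewrite realCB.
Qed.

Lemma psdmx_lambda_max A : A^t* = A -> psdmx ((lambda_max A)%:C%:M - A).
Proof.
move=> /hermitian_lambda_max[U [l [i0 [Uunitary AE -> l_max]]]].
rewrite AE diagin_subr//; apply: psdmx_diagin => i.
by rewrite ler0c subr_ge0.
Qed.

(** An eigenvector for the largest eigenvalue tests the form. With the previous lemma,
    [lambda_max A] is the least [c] for which [c - A] is positive semidefinite. *)
Lemma lambda_max_le A c : A^t* = A -> psdmx (c%:C%:M - A) -> lambda_max A <= c.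
Proof.
move=> /hermitian_lambda_max[U [l [i0 [Uunitary AE -> l_max]]]].
rewrite AE diagin_subr// => /(_ (row i0 U)).
by rewrite qform_diagin_row// ler0c subr_ge0.
Qed.

(** Nonnegative combinations of the positive semidefinite matrices [lambda_max (F i) - F i] are
    positive semidefinite. This is the convexity of [lambda_max]. *)
Lemma lambda_max_sum (I : finType) (F : I -> 'M[R[i]]_d) (a : I -> R) :
  (forall i, 0 <= a i) -> (forall i, (F i)^t* = F i) ->
  lambda_max (\sum_i (a i)%:C *: F i) <= \sum_i a i * lambda_max (F i).
Proof.
move=> a_ge0 Fherm; apply: lambda_max_le.
  rewrite adjmx_sum; apply: eq_bigr => i _.
  by rewrite adjmxZ Fherm conj_Creal// complex_real.
rewrite realC_sum raddf_sum -sumrB; apply: psdmx_sum => i.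
rewrite /= realCM -scale_scalar_mx -scalerBr; apply: psdmxZ; first by rewrite ler0c.
exact: psdmx_lambda_max.
Qed.

(** The norm is the root of the largest eigenvalue of [A ^+ 2], and squaring preserves the order of
    the nonnegative eigenvalues of [A]. *)
Lemma spectral_norm_psd A : A^t* = A -> psdmx A -> spectral_norm A = lambda_max A.
Proof.
move=> Aherm Apsd; rewrite /spectral_norm Aherm.
have [U [l [i0 [Uunitary AE lE l_max]]]] := hermitian_lambda_max Aherm.
have l_ge0 i : 0 <= l i.
  by have := Apsd (row i U); rewrite AE qform_diagin_row// ler0c.
rewrite -mxringM [in LHS]AE diaginM//.
under eq_diagin do rewrite -realCM.
have [j -> j_max] := lambda_max_diagin (fun i => l i * l i) Uunitary.
rewrite lE -expr2 sqrtr_sqr ger0_norm//; apply/eqP; rewrite eq_le l_max /=.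
by rewrite -(@ler_pXn2r _ 2)// ?nnegrE// !expr2 j_max.
Qed.

(** With an even exponent every eigenvalue contributes a nonnegative term to the trace, which
    therefore dominates the term of the largest one. *)
Lemma pow_le_mxtrace A t k : A^t* = A ->
  ((1 + t * lambda_max A) ^+ (2 ^ k.+1))%:C <= \tr ((1 + t%:C *: A) ^+ (2 ^ k.+1)).
Proof.
move=> /hermitian_lambda_max[U [l [i0 [Uunitary AE -> l_max]]]].
rewrite AE -(diagin1 Uunitary) diaginZ diaginD diaginX// mxtrace_diagin//.
have lE i : 1 + t%:C * (l i)%:C = (1 + t * l i)%:C by rewrite realCD realCM.
under eq_bigr do rewrite lE -realCX.
rewrite -realC_sum lecR (bigD1 i0)//= lerDl sumr_ge0// => i _.
by rewrite expnS exprM exprn_ge0// sqr_ge0.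
Qed.
End LambdaMax.

(** * Scalar inequalities *)

Section ScalarInequalities.
Context {R : realType}.
Implicit Types (x y c t a : R).

Lemma expR_ge_quadratic x : 0 <= x -> 1 + x + x ^+ 2 / 2 <= expR x.
Proof.
move=> x_ge0; have -> : 1 + x + x ^+ 2 / 2 = series (exp_coeff x) 3.
  rewrite /series /= !big_nat_recr//= big_geq// /exp_coeff /=.
  by rewrite !factS fact0 !mul1n expr0 expr1 add0r !divr1.
apply: nondecreasing_cvgn_le; last exact: is_cvg_series_exp_coeff.
apply/nondecreasing_seqP => n; rewrite /series /= big_nat_recr//= lerDl.
exact: exp_coeff_ge0.
Qed.

(** Since [(k + 2)! >= 2 * 3^k], the tail is dominated by a geometric series of ratio [x / 3]. *)
Lemma series_exp_coeff_le_pade x n : 0 <= x -> x < 3 ->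
  series (exp_coeff x) n <= 1 + x + x ^+ 2 / (2 * (1 - x / 3)).
Proof.
move=> x_ge0 x_lt3; have r_gt0 : 0 < 1 - x / 3 by lra.
have coef k : exp_coeff x k.+2 <= x ^+ 2 / 2 * (x / 3) ^+ k.
  elim: k => [|k IHk]; first by rewrite /exp_coeff /= expr0 mulr1.
  have -> : exp_coeff x k.+3 = exp_coeff x k.+2 * (x / k.+3%:R).
    by rewrite /exp_coeff /= mulf_div -exprSr -natrM mulnC -factS.
  rewrite [(x / 3) ^+ _]exprSr [leRHS]mulrA; apply: (ler_pM _ _ IHk).
  - exact: exp_coeff_ge0.
  - by rewrite divr_ge0.
  by rewrite ler_wpM2l// lef_pV2 ?posrE ?ltr0n// ler_nat.
have partial k : series (exp_coeff x) k.+2 <=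
    1 + x + x ^+ 2 / (2 * (1 - x / 3)) * (1 - (x / 3) ^+ k).
  elim: k => [|k IHk].
    rewrite /series /= !big_nat_recr//= big_geq// /exp_coeff /=.
    by rewrite factS fact0 mul1n expr0 expr1 add0r !divr1 subrr mulr0 addr0.
  rewrite /series /= big_nat_recr//=; apply: le_trans (lerD IHk (coef k)) _.
  rewrite -addrA lerD2l [(x / 3) ^+ k.+1]exprSr le_eqVlt; apply/orP; left; apply/eqP.
  by set q := (x / 3) ^+ k; field; lra.
have mono : {homo series (exp_coeff x) : i j / (i <= j)%N >-> i <= j}.
  apply/nondecreasing_seqP => k; rewrite /series /= big_nat_recr//= lerDl.
  exact: exp_coeff_ge0.
apply: le_trans (mono _ _ (leq_trans (leqnSn n) (leqnSn n.+1))) _.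
apply: le_trans (partial n) _; rewrite lerD2l ler_piMr//.
  by rewrite divr_ge0 ?exprn_ge0// mulr_ge0// ltW.
by rewrite gerBl exprn_ge0// divr_ge0.
Qed.

(** For [y >= 0] this is the series bound, with [y] enlarged to [c] in the denominator; for [y < 0]
    even [1 + y + y^2 / 2] is an upper bound. *)
Lemma expR_le_bernstein y c : 0 <= c -> c < 3 -> y <= c ->
  expR y <= 1 + y + y ^+ 2 / (2 * (1 - c / 3)).
Proof.
move=> c_ge0 c_lt3 y_lec.
have inv_le z : 0 <= z -> z <= c -> (2 * (1 - z / 3))^-1 <= (2 * (1 - c / 3))^-1.
  by move=> z_ge0 z_lec; rewrite lef_pV2 ?posrE; lra.
have [y_ge0|y_lt0] := leP 0 y.
  apply: (@le_trans _ _ (1 + y + y ^+ 2 / (2 * (1 - y / 3)))); last first.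
    by rewrite lerD2l ler_wpM2l ?exprn_ge0// inv_le.
  apply: limr_le; first exact: is_cvg_series_exp_coeff.
  apply: nearW => n; apply: series_exp_coeff_le_pade => //.
  exact: le_lt_trans c_lt3.
apply: (@le_trans _ _ (1 + y + y ^+ 2 / 2)); last first.
  rewrite lerD2l ler_wpM2l ?exprn_even_ge0//.
  by have := inv_le 0 (lexx 0) c_ge0; rewrite mul0r subr0 mulr1.
have yn : 0 <= - y by lra.
have pos : 0 < 1 - y + y ^+ 2 / 2 by nra.
have := expR_ge_quadratic yn; rewrite sqrrN expRN => h.
have e_gt0 := expR_gt0 y.
have : (1 - y + y ^+ 2 / 2) * expR y <= 1.
  by rewrite -ler_pdivlMr// mul1r.
(* The product equals [1 + y^4 / 4]. *)
have : 1 <= (1 - y + y ^+ 2 / 2) * (1 + y + y ^+ 2 / 2).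
  have : 0 <= (y ^+ 2) ^+ 2 by rewrite sqr_ge0.
  nra.
move=> h1 h2; rewrite -(ler_pM2l pos); exact: le_trans h2 h1.
Qed.

Lemma expR_pow_ge1D x n : 0 <= 1 + x -> (1 + x) ^+ n <= expR (n%:R * x).
Proof.
by move=> x_ge; rewrite expRM_natl lerXn2r ?nnegrE ?expR_ge0// expR_ge1Dx.
Qed.

(* Tangent line at [a] of the convex function [expR], for its approximation by
   powers. *)
Lemma pow_ge_tangent y a m : (0 < m)%N -> 2 * `|y| <= m%:R ->
  expR a * (1 + y - 2 * y ^+ 2 / m%:R - a) <= (1 + m%:R^-1 * y) ^+ m.
Proof.
move=> m_gt0 y_le; have m0 : 0 < m%:R :> R by rewrite ltr0n.
have := ler_norm y; have := ler_norm (- y); rewrite normrN => ny py.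
pose u := m%:R^-1 * y.
have uE : y = m%:R * u by rewrite /u mulVKf// gt_eqF.
have u_ge : - 2^-1 <= u by rewrite /u mulrC ler_pdivlMr//; lra.
(* [z] is a lower bound for the logarithm of [1 + u], and [z >= u - 2 u^2] because [u >= -1/2]. *)
pose z := u / (1 + u).
have u1 : 0 < 1 + u by lra.
have step : expR z <= 1 + u.
  have : 1 - z <= expR (- z) by rewrite expR_ge1Dx.
  have -> : 1 - z = (1 + u)^-1 by rewrite /z; field; lra.
  by rewrite expRN lef_pV2 ?posrE ?expR_gt0.
have : expR (m%:R * z) <= (1 + u) ^+ m.
  by rewrite expRM_natl lerXn2r ?nnegrE ?expR_ge0 // ltW.
apply: le_trans.
have -> : m%:R * z = a + (m%:R * z - a) by ring.
rewrite expRD ler_wpM2l ?expR_ge0//; apply: le_trans (expR_ge1Dx _).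
suff : y - 2 * y ^+ 2 / m%:R <= m%:R * z by lra.
have -> : 2 * y ^+ 2 / m%:R = m%:R * (2 * u ^+ 2).
  by rewrite uE; field; lra.
rewrite [in leLHS]uE -mulrBr ler_pM2l// /z ler_pdivlMr//.
have := sqr_ge0 u; nra.
Qed.

(** The minimum over [s] is not computed: if [x] exceeded the bound, [s = x / (2 D)] would give
    [x^2 <= 2 v D], a contradiction. *)
Lemma le_sqrt_of_tradeoff x D v : 0 <= D -> 0 <= v ->
  (forall s, 0 < s -> x <= D * s + v / (2 * s)) -> x <= Num.sqrt (2 * v * D).
Proof.
move=> D_ge0 v_ge0 le_x; rewrite leNgt; apply/negP => lt_x.
have x_gt0 : 0 < x := le_lt_trans (sqrtr_ge0 _) lt_x.
have : 2 * v * D < x ^+ 2.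
  rewrite -(@ltr_sqrt _ (2 * v * D)) ?exprn_gt0// sqrtr_sqr gtr0_norm//.
(* This case arises for [d = 1], where [ln d] vanishes; a large [s] then makes [v / (2 s)] smaller
   than [x]. *)
have [D0|D_neq0] := eqVneq D 0.
  move=> _; have s_gt0 : 0 < v / x + 1 by rewrite ltr_wpDl// divr_ge0// ltW.
  have := le_x _ s_gt0; rewrite D0 mul0r add0r ler_pdivlMr; last by lra.
  have -> : x * (2 * (v / x + 1)) = 2 * v + 2 * x by field; rewrite gt_eqF.
  lra.
have D_gt0 : 0 < D by rewrite lt_neqAle eq_sym D_neq0.
have := le_x (x / (2 * D)); rewrite divr_gt0 ?mulr_gt0// => /(_ isT).
have -> : D * (x / (2 * D)) + v / (2 * (x / (2 * D))) = x / 2 + v * D / x.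
  by field; rewrite !gt_eqF.
move=> h1 h2; have : x / 2 <= v * D / x by lra.
by rewrite ler_pdivlMr//; lra.
Qed.

End ScalarInequalities.

(** * Matrix Bernstein inequality over all maps *)

Section FfunCons.
Variables (U : finType) (n : nat).

Definition fcons (u : U) (s : {ffun 'I_n -> U}) : {ffun 'I_n.+1 -> U} :=
  [ffun i => oapp s u (unlift ord0 i)].

Lemma fcons0 u s : fcons u s ord0 = u.
Proof. by rewrite ffunE unlift_none. Qed.

Lemma fconsS u s i : fcons u s (lift ord0 i) = s i.
Proof. by rewrite ffunE liftK. Qed.

Lemma sum_fcons (V : nmodType) (h : {ffun 'I_n.+1 -> U} -> V) :
  \sum_s h s = \sum_s \sum_u h (fcons u s).
Proof.
rewrite pair_big /=.
rewrite (reindex (fun p : {ffun 'I_n -> U} * U => fcons p.2 p.1))//=.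
exists (fun s => ([ffun i => s (lift ord0 i)], s ord0)) => [[s u] _|s _] /=.
  by congr (_, _); [apply/ffunP => i; rewrite ffunE fconsS | rewrite fcons0].
apply/ffunP => i; rewrite ffunE; case: unliftP => [j ->|->] //=.
by rewrite ffunE.
Qed.
End FfunCons.

(** * The Ahlswede-Winter induction on the number of samples *)

Section AhlswedeWinter.
Context {R : realType} {d : nat} {U : finType}.
Variable G : U -> 'M[R[i]]_d.
Hypothesis Gherm : forall u, (G u)^t* = G u.

Lemma ler_norm_subD (C : numDomainType) (x y e : C) :
  0 <= x -> `|x - y| <= e -> x <= `|y| + e.
Proof.
move=> x_ge0 le_e; rewrite -[x in leLHS](ger0_norm x_ge0) -[x in leLHS](subrK y).
by rewrite addrC; apply: le_trans (ler_normD _ _) _; rewrite lerD2l.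
Qed.

Lemma herm_step (A : 'M[R[i]]_d) m : A^t* = A ->
  (1 + m%:R^-1 *: A)^t* = 1 + m%:R^-1 *: A.
Proof.
by move=> Aherm; rewrite adjmxD adjmxZ Aherm trmx1 map_mx1 conj_Creal.
Qed.

Lemma herm_sum n (s : {ffun 'I_n -> U}) : (\sum_i G (s i))^t* = \sum_i G (s i).
Proof. by rewrite adjmx_sum; apply: eq_bigr => i _. Qed.

(** Even powers of Hermitian matrices are Gram matrices, hence positive semidefinite; this is why
    exponents are [2 ^ k.+1] and not [2 ^ k]. *)
Lemma pow2_gram (H : 'M[R[i]]_d) k : H^t* = H ->
  H ^+ (2 ^ k.+1) = H ^+ (2 ^ k) * (H ^+ (2 ^ k))^t*.
Proof. by move=> HE; rewrite adjmxX HE -exprD addnn -mul2n -expnS. Qed.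

(** The product formula followed by Golden-Thompson; both traces are nonnegative, which removes the
    absolute values. [K] is fixed before [k], so the error vanishes as [k] grows. *)
Lemma mxtrace_pow_step_le (A B : 'M[R[i]]_d) : A^t* = A -> B^t* = B ->
  exists2 K : R, 0 <= K & forall k,
  let m := (2 ^ k.+1)%N in
  \tr ((1 + m%:R^-1 *: (A + B)) ^+ m) <=
  \tr ((1 + m%:R^-1 *: A) ^+ m * (1 + m%:R^-1 *: B) ^+ m) + (K / m%:R)%:C.
Proof.
move=> Aherm Bherm; have [K K_ge0 leK] := mxtrace_lie_product A B.
exists K => // k; cbv zeta; set m := (2 ^ k.+1)%N.
have m_gt0 : (0 < m)%N by rewrite expn_gt0.
have ABherm : (A + B)^t* = A + B by rewrite adjmxD Aherm Bherm.
have psd_tr (P Q : 'M[R[i]]_d) : P^t* = P -> Q^t* = Q -> 0 <= \tr (P ^+ m * Q ^+ m).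
  move=> PE QE; rewrite /m pow2_gram//; apply: mxtrace_gramM_ge0.
  by rewrite pow2_gram//; exact: psdmx_gram.
have tr_ge0 : 0 <= \tr ((1 + m%:R^-1 *: (A + B)) ^+ m).
  have := psd_tr _ 1 (herm_step m ABherm); rewrite expr1n mulr1; apply.
  by rewrite trmx1 map_mx1.
have /le_trans := ler_norm_subD tr_ge0 (leK m m_gt0).
apply; rewrite lerD2r.
apply: le_trans (golden_thompson_pow _ (herm_step m Aherm) (herm_step m Bherm)) _.
by rewrite ger0_norm//; apply: psd_tr; exact: herm_step.
Qed.

(** Induction on [n], splitting off one sample: by linearity its sum over [u] passes inside the
    trace, where it is at most [c]. Each sample thus costs a factor [c]. *)
Lemma sum_mxtrace_pow_le (c : R) k0 : 0 <= c ->
  (forall k, (k0 <= k)%N ->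
    psdmx (c%:C%:M - \sum_u (1 + (2 ^ k.+1)%:R^-1 *: G u) ^+ (2 ^ k.+1))) ->
  forall n, exists2 K : R, 0 <= K & forall k, (k0 <= k)%N ->
    \sum_(s : {ffun 'I_n -> U})
       \tr ((1 + (2 ^ k.+1)%:R^-1 *: \sum_i G (s i)) ^+ (2 ^ k.+1)) <=
    (c ^+ n * d%:R + K / (2 ^ k.+1)%:R)%:C.
Proof.
move=> c_ge0 Gc; elim=> [|n [K K_ge0 leK]].
  exists 0 => // k _; rewrite (eq_bigr (fun=> d%:R)) => [|s _].
    rewrite sumr_const card_ffun card_ord expn0 expr0 mul1r mul0r addr0.
    by rewrite realC_nat.
  by rewrite big_ord0 scaler0 addr0 expr1n mxtrace1.
pose tr1 k (s : {ffun 'I_n -> U}) u :=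
  \tr ((1 + (2 ^ k.+1)%:R^-1 *: \sum_i G (s i)) ^+ (2 ^ k.+1) *
       (1 + (2 ^ k.+1)%:R^-1 *: G u) ^+ (2 ^ k.+1)).
(* The error constants depend on the pair but not on [k]; as there are finitely many pairs, they can
   be added up. *)
have /choice[Kp KpP] : forall p : {ffun 'I_n -> U} * U, exists K' : R, 0 <= K' /\
    forall k, \tr ((1 + (2 ^ k.+1)%:R^-1 *: (\sum_i G (p.1 i) + G p.2)) ^+ (2 ^ k.+1))
      <= tr1 k p.1 p.2 + (K' / (2 ^ k.+1)%:R)%:C.
  move=> [s u].
  by have [K' ? ?] := mxtrace_pow_step_le (herm_sum s) (Gherm u); exists K'.
exists (c * K + \sum_s \sum_u Kp (s, u)) => [|k k0_le].
  rewrite addr_ge0 ?mulr_ge0 ?sumr_ge0// => s _; apply: sumr_ge0 => u _.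
  exact: (KpP _).1.
rewrite sum_fcons; set m := (2 ^ k.+1)%N.
apply: (@le_trans _ _ (\sum_s \sum_u (tr1 k s u + (Kp (s, u) / m%:R)%:C))).
  apply: ler_sum => s _; apply: ler_sum => u _.
  rewrite (_ : \sum_i G (fcons u s i) = \sum_i G (s i) + G u).
    exact: (KpP (s, u)).2 k.
  rewrite big_ord_recl fcons0 addrC; congr (_ + _).
  by apply: eq_bigr => i _; rewrite fconsS.
under eq_bigr do rewrite big_split /=.
rewrite big_split /=.
have -> : \sum_s \sum_u (Kp (s, u) / m%:R)%:C =
    ((\sum_s \sum_u Kp (s, u)) / m%:R)%:C.
  rewrite mulr_suml realC_sum; apply: eq_bigr => s _.
  by rewrite mulr_suml realC_sum.
rewrite mulrDl addrA realCD lerD2r exprS -!mulrA -mulrDr realCM.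
apply: le_trans (ler_wpM2l _ (leK k k0_le)); last by rewrite ler0c.
rewrite -/m /tr1 -/m.
rewrite mulr_sumr; apply: ler_sum => s _.
rewrite -raddf_sum -mulr_sumr -subr_ge0.
set P := (1 + _) ^+ m.
have -> : c%:C * \tr P - \tr (P * \sum_i (1 + m%:R^-1 *: G i) ^+ m) =
   \tr (P * (c%:C%:M - \sum_i (1 + m%:R^-1 *: G i) ^+ m)).
  by rewrite mulrBr raddfB /= [P * _%:M]mxringM mul_mx_scalar mxtraceZ.
rewrite /P /m pow2_gram; last exact/herm_step/herm_sum.
apply: mxtrace_gramM_ge0; exact: Gc.
Qed.

End AhlswedeWinter.

(** * From trace bounds to the Bernstein bound over all maps *)

Section FiniteBernstein.
Context {R : realType} {d : nat}.
Hypothesis d_gt0 : (0 < d)%N.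

Lemma pow2_ge (x : R) : exists k0, forall k, (k0 <= k)%N -> x <= (2 ^ k.+1)%:R.
Proof.
exists (Num.bound `|x|) => k k0_le; apply: le_trans (ler_norm x) _.
apply: le_trans (ltW (archi_boundP (normr_ge0 x))) _.
by rewrite ler_nat; apply: leq_trans k0_le _; apply: leq_trans (ltnW (ltn_expl k.+1 _)).
Qed.

Lemma ler_pow2_lim (x y K : R) k0 :
  (forall k, (k0 <= k)%N -> x <= y + K / (2 ^ k.+1)%:R) -> x <= y.
Proof.
move=> le_x; apply/ler_addgt0Pr => e e_gt0.
have [k1 k1P] := pow2_ge (K / e).
apply: le_trans (le_x _ (leq_maxl k0 k1)) _; rewrite lerD2l.
by rewrite ler_pdivrMr ?ltr0n ?expn_gt0// mulrC -ler_pdivrMr// k1P// leq_maxr.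
Qed.

Lemma eventually_forall (I : finType) (Q : I -> nat -> Prop) :
  (forall i, exists k0, forall k, (k0 <= k)%N -> Q i k) ->
  exists k0, forall k, (k0 <= k)%N -> forall i, Q i k.
Proof.
move=> /choice[f fP]; exists (\max_i f i)%N => k k_ge i.
by apply: fP; apply: leq_trans k_ge; exact: leq_bigmax.
Qed.

(** Diagonalization reduces this to [(1 + y / m)^m <= exp y] and the scalar Bernstein bound at
    [y = t * l i]. The first needs [1 + y / m >= 0], which holds for large [m]. *)
Lemma psdmx_pow_bernstein (A : 'M[R[i]]_d) (L t : R) :
  A^t* = A -> lambda_max A <= L -> 0 <= L -> 0 <= t -> t * L < 3 ->
  exists k0, forall k, (k0 <= k)%N ->
  psdmx (1 + t%:C *: A + (t ^+ 2 / (2 * (1 - t * L / 3)))%:C *: A ^+ 2 -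
    (1 + (2 ^ k.+1)%:R^-1 *: (t%:C *: A)) ^+ (2 ^ k.+1)).
Proof.
move=> /(hermitian_lambda_max d_gt0)[U [l [i0 [Uunitary -> -> l_max]]]] l0_leL L_ge0 t_ge0 tL.
have [k0 k0P] := eventually_forall (fun i => pow2_ge (- (t * l i))).
exists k0 => k /k0P; set m := (2 ^ k.+1)%N => {k0P} m_ge.
have m_gt0 : (0 < m)%N by rewrite expn_gt0.
move: m m_gt0 m_ge => m m_gt0 m_ge.
set g := t ^+ 2 / _.
rewrite -(diagin1 Uunitary).
rewrite (diaginX Uunitary _ 2).
rewrite !diaginZ.
rewrite !diaginD.
rewrite (diaginX Uunitary _ m).
rewrite diaginB.
apply: psdmx_diagin => i.
have m0 : 0 < m%:R :> R by rewrite ltr0n.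
have -> : 1 + t%:C * (l i)%:C + g%:C * (l i)%:C ^+ 2 -
    (1 + m%:R^-1 * (t%:C * (l i)%:C)) ^+ m =
    (1 + t * l i + g * l i ^+ 2 - (1 + m%:R^-1 * (t * l i)) ^+ m)%:C.
  rewrite realCB (realCX (1 + _)) !realCD !realCM expr2 ?realCM.
  by rewrite [(m%:R^-1)%:C]fmorphV /= realC_nat.
rewrite ler0c subr_ge0.
have y_le : t * l i <= t * L by rewrite ler_wpM2l// (le_trans (l_max i)).
have := expR_le_bernstein (mulr_ge0 t_ge0 L_ge0) tL y_le.
have -> : (t * l i) ^+ 2 / (2 * (1 - t * L / 3)) = g * l i ^+ 2.
  by rewrite /g exprMn mulrAC.
have yE : t * l i = m%:R * (m%:R^-1 * (t * l i)) by rewrite mulVKf ?gt_eqF.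
apply: le_trans; rewrite [in leRHS]yE; apply: expR_pow_ge1D.
rewrite -(ler_pM2l m0) mulr0 mulrDr mulr1 -yE.
by rewrite -lerBlDr sub0r.
Qed.

Section Family.
Context {U : finType} {n : nat}.
Variables (F : U -> 'M[R[i]]_d) (L v : R).
Hypotheses (Fherm : forall u, (F u)^t* = F u) (F_le : forall u, lambda_max (F u) <= L).
Hypotheses (F0 : \sum_u F u = 0) (L_ge0 : 0 <= L) (v_ge0 : 0 <= v) (n_gt0 : (0 < n)%N).
(** In the semidefinite order, [n] times the mean of [F u ^+ 2] is at most [v]. *)
Hypothesis Fv : psdmx ((#|U|%:R * (v / n%:R))%:C%:M - \sum_u F u ^+ 2).

Lemma sum_lambda_max_le t : 0 < t -> t * L < 3 ->
  t * \sum_(s : {ffun 'I_n -> U}) lambda_max (\sum_i F (s i)) <=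
  #|U|%:R ^+ n * (ln d%:R + t ^+ 2 / (2 * (1 - t * L / 3)) * v).
Proof.
move=> t_gt0 tL; pose g := t ^+ 2 / (2 * (1 - t * L / 3)); rewrite -/g; set N := #|U|%:R : R.
have g_ge0 : 0 <= g by rewrite divr_ge0 ?sqr_ge0// mulr_ge0//; lra.
have dR : 0 < d%:R :> R by rewrite ltr0n.
have nR : 0 < n%:R :> R by rewrite ltr0n.
(* [c] bounds the sum over [u] of the powers: the linear terms cancel by [F0], and the quadratic
   ones are bounded by [Fv]. *)
pose c := N * (1 + g * (v / n%:R)).
have c_ge0 : 0 <= c.
  by rewrite mulr_ge0// addr_ge0// mulr_ge0// divr_ge0.
pose G u := t%:C *: F u.
have Gherm u : (G u)^t* = G u.
  by rewrite adjmxZ Fherm conj_Creal// complex_real.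
have [k0 k0P] := eventually_forall
  (fun u => psdmx_pow_bernstein (Fherm u) (F_le u) L_ge0 (ltW t_gt0) tL).
have Gc k : (k0 <= k)%N ->
    psdmx (c%:C%:M - \sum_u (1 + (2 ^ k.+1)%:R^-1 *: G u) ^+ (2 ^ k.+1)).
  move=> /k0P {}k0P; have gFv := psdmxZ (_ : 0 <= g%:C) Fv.
  rewrite ler0c in gFv; have := psdmxD (psdmx_sum k0P) (gFv g_ge0).
  congr psdmx; rewrite sumrB !big_split /= -!scaler_sumr F0 scaler0 addr0 scalerBr.
  rewrite -/g; have -> : c%:C%:M = \sum_(u : U) (1 : 'M[R[i]]_d) + g%:C *: (N * (v / n%:R))%:C%:M.
    rewrite sumr_const scale_scalar_mx -[1 in RHS]/(1%:M) -raddfMn -raddfD.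
    by congr _%:M; rewrite /= -realC_nat -realCM -realCD /c; congr _%:C; ring.
  rewrite addrACA [_ + g%:C *: \sum_u _ + _]addrAC [- _ - _]addrC addrA.
  by rewrite addrK.
have [K K_ge0 leK] := sum_mxtrace_pow_le Gherm c_ge0 Gc n.
(* [exp a] bounds the mean trace up to [O(1/m)], so the tangent line to [expR] at this very point
   gives, in the limit, a mean of [t * lam] of at most [a]. *)
set a := ln d%:R + g * v.
have cn : c ^+ n * d%:R <= N ^+ n * expR a.
  rewrite /c exprMn -mulrA ler_wpM2l ?exprn_ge0// /a expRD lnK ?posrE// mulrC.
  rewrite ler_wpM2l ?ler0n//; have -> : g * v = n%:R * (g * (v / n%:R)).
    by rewrite mulrCA [n%:R * _]mulrC divfK ?gt_eqF.
  by apply: expR_pow_ge1D; rewrite addr_ge0// mulr_ge0// divr_ge0.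
pose lam (s : {ffun 'I_n -> U}) := lambda_max (\sum_i F (s i)).
have [k1 k1P] := eventually_forall (fun s => pow2_ge (2 * `|t * lam s|)).
have Fsum (s : {ffun 'I_n -> U}) : (\sum_i F (s i))^t* = \sum_i F (s i).
  exact: herm_sum.
rewrite -/(lam _) -(ler_pM2l (expR_gt0 a)).
(* The constant gathers the error of the trace bound and the quadratic errors of the tangent
   lines. *)
apply: (@ler_pow2_lim _ _ (K + expR a * \sum_s 2 * (t * lam s) ^+ 2) (maxn k0 k1)).
move=> k; rewrite geq_max => /andP[k0_le k1_le].
have {leK} := leK k k0_le.
have m_gt0 : (0 < 2 ^ k.+1)%N by rewrite expn_gt0.
have tangent s := pow_ge_tangent a m_gt0 (k1P k k1_le s).
have lower : (\sum_s (1 + (2 ^ k.+1)%:R^-1 * (t * lam s)) ^+ (2 ^ k.+1))%:C <=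
    \sum_(s : {ffun 'I_n -> U})
     \tr ((1 + (2 ^ k.+1)%:R^-1 *: \sum_i G (s i)) ^+ (2 ^ k.+1)).
  rewrite realC_sum; apply: ler_sum => s _.
  have := pow_le_mxtrace d_gt0 ((2 ^ k.+1)%:R^-1 * t) k (Fsum s).
  by rewrite -/(lam s) -mulrA /G -scaler_sumr scalerA realCM [(_^-1)%:C]fmorphV /= realC_nat.
move=> /(le_trans lower); rewrite lecR.
move: (2 ^ k.+1)%N m_gt0 tangent => m m_gt0 tangent upper {lower}.
have := le_trans (ler_sum _ (fun s _ => tangent s)) upper.
rewrite -!mulr_sumr !sumrB big_split /= -mulr_suml -!mulr_sumr !sumr_const.
rewrite -[\sum_s lambda_max _]/(\sum_s lam s).
rewrite card_ffun card_ord -[a *+ _]mulr_natl natrX -/N.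
move: (m%:R^-1) (\sum_s _) (\sum_s _) (expR a) (N ^+ n) (c ^+ n * _) cn.
by clear=> w T Q E M B cn h; lra.
Qed.

Lemma finite_matrix_bernstein : (0 < #|U|)%N ->
  \sum_(s : {ffun 'I_n -> U}) lambda_max (\sum_i F (s i)) <=
  #|U|%:R ^+ n * (Num.sqrt (2 * v * ln d%:R) + 3^-1 * L * ln d%:R).
Proof.
move=> U_gt0; set S := \sum_s _; set D := ln d%:R.
have D_ge0 : 0 <= D by rewrite ln_ge0// ler1n.
have N_gt0 : 0 < #|U|%:R ^+ n :> R by rewrite exprn_gt0// ltr0n.
rewrite mulrC -ler_pdivrMr//; set x := S / _.
(* Once [1 / t = s + L / 3] is substituted, this term is the part of the bound free of [s]; the rest
   is the tradeoff [D * s + v / (2 * s)]. *)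
suff : x - 3^-1 * L * D <= Num.sqrt (2 * v * D) by lra.
apply: le_sqrt_of_tradeoff => // s s_gt0.
have w_gt0 : 0 < s + L / 3 by rewrite ltr_wpDr// divr_ge0.
have := sum_lambda_max_le (t := (s + L / 3)^-1).
rewrite invr_gt0 => /(_ w_gt0); rewrite -/S.
have -> : 1 - (s + L / 3)^-1 * L / 3 = s / (s + L / 3).
  by field; rewrite gt_eqF//; lra.
rewrite mulrC ltr_pdivrMr// => /(_ ltac:(lra)).
rewrite mulrC ler_pdivrMr// -/D => h.
have : x <= (s + L / 3) * (D + (s + L / 3)^-1 ^+ 2 / (2 * (s / (s + L / 3))) * v).
  rewrite ler_pdivrMr//; move: h; set B := D + _.
  by rewrite -mulrA [_ * (B * _)]mulrC [B * _]mulrC.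
have -> : (s + L / 3) * (D + (s + L / 3)^-1 ^+ 2 / (2 * (s / (s + L / 3))) * v) =
    (s + L / 3) * D + v / (2 * s).
  by field; rewrite !gt_eqF//; lra.
lra.
Qed.
End Family.
End FiniteBernstein.

(** * Hoeffding's comparison *)

Section InjectiveMaps.
Context {U : finType} {n : nat}.

(** The symmetric group on [U] is [n]-transitive. *)
Lemma perm_extension (u w : 'I_n -> U) : injective u -> injective w ->
  exists t : {perm U}, forall k, t (u k) = w k.
Proof.
move=> u_inj w_inj; have n_le : (n <= #|U|)%N.
  by rewrite -[n]card_ord; apply: leq_card u_inj.
have dt (h : 'I_n -> U) : injective h -> [tuple h i | i < n] \in n.-dtuple([set: U]%SET).
  move=> h_inj; apply/dtuple_onP; split=> [i j|i]; last by rewrite finset.in_setT.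
  by rewrite !tnth_mktuple => /h_inj.
have tr := ntransitive_weak n_le (Sym_trans U).
have [t _ tE] := atransP2 tr (dt _ u_inj) (dt _ w_inj).
exists t => k; have := congr1 (fun x => tnth x k) tE.
by rewrite tnth_mktuple /= /n_act tnth_map tnth_mktuple => ->.
Qed.

Lemma injective_factor (s : 'I_n -> U) : (n <= #|U|)%N ->
  exists u (p : 'I_n -> 'I_n), injective u /\ forall k, s k = u (p k).
Proof.
(* [w] lists the population with the values of [s] first. There are at most [n] such values, so the
   first [n] entries of [w] form [u] and positions in [w] form [p]. *)
move=> n_le; pose c := undup (codom s).
pose w := c ++ [seq x <- enum U | x \notin c].
have w_uniq : uniq w.
  rewrite cat_uniq undup_uniq filter_uniq ?enum_uniq// andbT.
  by apply/hasPn => x; rewrite mem_filter => /andP[].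
have size_w : size w = #|U|.
  rewrite -(card_uniqP w_uniq); apply: eq_card => x.
  by rewrite mem_cat mem_filter mem_enum !inE andbT orbN.
have size_c : (size c <= n)%N.
  by apply: leq_trans (size_undup _) _; rewrite size_codom card_ord.
have s_c k : s k \in c by rewrite mem_undup codom_f.
have p_lt k : (index (s k) w < n)%N.
  by rewrite index_cat s_c (leq_trans _ size_c)// index_mem.
(* [s i] is only the default of [nth], never reached because [n <= size w]. *)
exists (fun i => nth (s i) w i), (fun k => Ordinal (p_lt k)); split=> [i j|k].
  rewrite (set_nth_default (s j)) => [/eqP|]; last by rewrite size_w (leq_trans _ n_le).
  by rewrite nth_uniq ?size_w ?(leq_trans _ n_le)// => /eqP/val_inj.
by rewrite nth_index// mem_cat s_c.
Qed.
End InjectiveMaps.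

Section Hoeffding.
Context {R : realType} {n : nat} {U : finType}.
Hypothesis n_le : (n.+1 <= #|U|)%N.
Variable lam : ('I_n.+1 -> U) -> R.
(** The form in which convexity enters; the addition in ['I_n.+1] is modulo [n.+1]. *)
Hypothesis lam_rotations : forall (p : 'I_n.+1 -> 'I_n.+1) (t : 'I_n.+1 -> U),
  n.+1%:R * lam t <= \sum_(r < n.+1) lam (fun k => t (p k + r)).

(** Some permutation carries [u] to [w], and translation by it only reorders the summands. *)
Lemma sum_perm_injective (u w : 'I_n.+1 -> U) (p : 'I_n.+1 -> 'I_n.+1) :
  injective u -> injective w ->
  \sum_(g : {perm U}) lam (fun k => g (u (p k))) =
  \sum_(g : {perm U}) lam (fun k => g (w (p k))).
Proof.
move=> u_inj w_inj; have [t tE] := perm_extension u_inj w_inj.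
rewrite [LHS](reindex_inj (h := mulg t) (@mulgI _ t)); apply: eq_bigr => g _.
by congr lam; apply/funext => k; rewrite permM tE.
Qed.

(** Write [s] as [w] after [p] with [w] injective. Every rotation of [w] is again injective, so each
    of the [n.+1] rotated sums equals the sum for [s]. *)
Lemma sum_perm_injective_le (u s : 'I_n.+1 -> U) : injective u ->
  \sum_(g : {perm U}) lam (fun k => g (u k)) <=
  \sum_(g : {perm U}) lam (fun k => g (s k)).
Proof.
move=> u_inj; have [w [p [w_inj sE]]] := injective_factor s n_le.
have n0 : 0 < n.+1%:R :> R by rewrite ltr0n.
have -> : \sum_(g : {perm U}) lam (fun k => g (u k)) =
    \sum_(g : {perm U}) lam (fun k => g (w k)) := @sum_perm_injective u w (fun k => k) u_inj w_inj.
rewrite -(ler_pM2l n0) mulr_sumr.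
apply: (@le_trans _ _ (\sum_(g : {perm U}) \sum_(r < n.+1) lam (fun k => g (w (p k + r))))).
  by apply: ler_sum => g _; exact: (lam_rotations p (fun k => g (w k))).
rewrite exchange_big /= mulr_natl -[X in _ *+ X](card_ord n.+1) -sumr_const.
apply: ler_sum => r _.
rewrite [leLHS](_ : _ = \sum_(g : {perm U}) lam (fun k => g (s k)))//.
have wr_inj : injective (fun k => w (k + r)) by move=> i j /w_inj/addIr.
rewrite [LHS](sum_perm_injective p wr_inj w_inj); apply: eq_bigr => g _.
by congr lam; apply/funext => k; rewrite sE.
Qed.

Lemma sum_perm_comp (D : pred {ffun 'I_n.+1 -> U}) :
  (forall (g : {perm U}) (s : {ffun 'I_n.+1 -> U}), D [ffun k => g (s k)] = D s) ->
  \sum_(s | D s) \sum_(g : {perm U}) lam (fun k => g (s k)) =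
  #|{perm U}|%:R * \sum_(s | D s) lam s.
Proof.
move=> D_inv; rewrite exchange_big /= (eq_bigr (fun=> \sum_(s | D s) lam s)) => [|g _].
  by rewrite sumr_const mulr_natl.
rewrite [RHS](reindex (fun s : {ffun 'I_n.+1 -> U} => [ffun k => g (s k)])) /=.
  apply: eq_big => [s|s _]; first by rewrite D_inv.
  by congr lam; apply/funext => k; rewrite ffunE.
exists (fun s => [ffun k => (g^-1)%g (s k)]) => s _; apply/ffunP => k.
  by rewrite !ffunE permK.
by rewrite !ffunE permKV.
Qed.

(** After averaging over permutations both sides become sums over pairs of an injection and an
    arbitrary map, and the inequality holds pair by pair. *)
Lemma sum_injective_le :
  #|U|%:R ^+ n.+1 * \sum_(t : {ffun 'I_n.+1 -> U} | injectiveb t) lam t <=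
  #|[set t : {ffun 'I_n.+1 -> U} | injectiveb t]|%:R *
    \sum_(s : {ffun 'I_n.+1 -> U}) lam s.
Proof.
have P_gt0 : 0 < #|{perm U}|%:R :> R by rewrite ltr0n; apply/card_gt0P; exists 1%g.
rewrite -(ler_pM2l P_gt0) mulrCA [leRHS]mulrCA.
have -> : #|{perm U}|%:R * \sum_(t : {ffun 'I_n.+1 -> U} | injectiveb t) lam t =
   \sum_(t : {ffun 'I_n.+1 -> U} | injectiveb t)
     \sum_(g : {perm U}) lam (fun k => g (t k)).
  rewrite sum_perm_comp// => g s; apply/injectiveP/injectiveP => s_inj i j.
    by move=> sij; apply: s_inj; rewrite !ffunE sij.
  by rewrite !ffunE => /perm_inj/s_inj.
rewrite -(sum_perm_comp (D := predT))//.
have -> : #|U|%:R ^+ n.+1 = \sum_(s : {ffun 'I_n.+1 -> U}) 1 :> R.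
  by rewrite sumr_const card_ffun card_ord natrX.
have -> : #|[set t : {ffun 'I_n.+1 -> U} | injectiveb t]|%:R =
    \sum_(t : {ffun 'I_n.+1 -> U} | injectiveb t) 1 :> R.
  by rewrite -sum1_card natr_sum; apply: eq_bigl => t; rewrite inE.
rewrite !mulr_suml [leRHS](eq_bigr _ (fun t _ => mul1r _)).
rewrite (eq_bigr _ (fun s _ => mul1r _)) [leLHS]exchange_big /=.
apply: ler_sum => t /injectiveP t_inj; apply: ler_sum => s _.
exact: sum_perm_injective_le.
Qed.
End Hoeffding.

(** For fixed [k], [p k + r] runs once through all indices as [r] varies, so the rotated sums have
    mean [\sum_k F (t k)]; convexity of [lambda_max] concludes. *)
Lemma lambda_max_le_rotations (R : realType) (d n : nat) (U : Type)
    (F : U -> 'M[R[i]]_d) (p : 'I_n.+1 -> 'I_n.+1) (t : 'I_n.+1 -> U) :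
  (0 < d)%N -> (forall u, (F u)^t* = F u) ->
  n.+1%:R * lambda_max (\sum_k F (t k)) <=
  \sum_(r < n.+1) lambda_max (\sum_k F (t (p k + r))).
Proof.
move=> d_gt0 Fherm.
have n0 : 0 < n.+1%:R :> R by rewrite ltr0n.
pose S (r : 'I_n.+1) := \sum_k F (t (p k + r)).
have Sherm r : (S r)^t* = S r by rewrite adjmx_sum; apply: eq_bigr.
have tE : \sum_k F (t k) = \sum_r (n.+1%:R^-1)%:C *: S r.
  have -> : \sum_r (n.+1%:R^-1)%:C *: S r = (n.+1%:R^-1)%:C *: ((\sum_k F (t k)) *+ n.+1).
    rewrite -scaler_sumr exchange_big /=; congr (_ *: _).
    rewrite -[X in _ *+ X](card_ord n.+1) -sumr_const.
    by apply: eq_bigr => k _; rewrite [RHS](reindex_inj (addrI (p k))).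
  rewrite -scalerMnr scalerMnl -[_%:C *+ _]mulr_natr -realC_nat -realCM.
  by rewrite mulVf ?gt_eqF// scale1r.
by rewrite [in leLHS]tE -ler_pdivlMl// mulr_sumr; apply: lambda_max_sum.
Qed.

(** * Expectations of uniform samples *)

Local Open Scope fset_scope.
Local Open Scope classical_set_scope.
Local Open Scope ring_scope.
Local Open Scope complex_scope.
Local Open Scope sesquilinear_scope.

Section UniformExpectation.
Context {dO : measure_display} {Omega : measurableType dO} {R : realType}.
Variable P : probability Omega R.
Context {U : finType}.

Lemma expectation_uniform (D : {set U}) (Z : Omega -> U) (g : U -> R) :
  uniform_on P D Z ->
  ('E_P[fun w => g (Z w)] = (#|D|%:R^-1 * \sum_(u in D) g u)%:E)%E.
Proof.
move=> Zunif; rewrite unlock.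
pose f u w : \bar R := ((g u)%:E * (\1_(Z @^-1` [set u]) w)%:E)%E.
have f_int u : P.-integrable setT (f u).
  by apply: integrableZl => //; apply: integrable_indic => //; exact: (Zunif u).1.
transitivity (\int[P]_w (\sum_u f u w))%E.
  apply: eq_integral => w _; rewrite (bigD1 (Z w))//= big1 => [|u ne_uZ].
    by rewrite adde0 /f indicE mem_set//= mule1.
  by rewrite /f indicE memNset ?mule0// => /esym/eqP; rewrite (negPf ne_uZ).
rewrite integral_sum//.
have fE u : (\int[P]_w f u w = (if u \in D then #|D|%:R^-1 * g u else 0)%:E)%E.
  have [mu Pu] := Zunif u.
  rewrite integralZl//; last exact: integrable_indic.
  rewrite integral_indic// setIT.
  transitivity ((g u)%:E * (if u \in D then (#|D|%:R^-1)%:E else 0%E))%E.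
    by congr (_ * _)%E; exact: Pu.
  by case: ifP; rewrite ?mule0// -EFinM mulrC.
rewrite (eq_bigr _ (fun u _ => fE u)) sumEFin -big_mkcond mulr_sumr.
by [].
Qed.

Lemma mexpectation_uniform d (D : {set U}) (Z : Omega -> U) (F : U -> 'M[R[i]]_d) :
  uniform_on P D Z ->
  mexpectation P (fun w => F (Z w)) = (#|D|%:R^-1)%:C *: \sum_(u in D) F u.
Proof.
move=> Zunif; apply/matrixP => i j; rewrite !mxE summxE.
rewrite (expectation_uniform (fun u => complex.Re (F u i j)) Zunif).
rewrite (expectation_uniform (fun u => complex.Im (F u i j)) Zunif) /=.
have -> : \sum_(u in D) F u i j =
    (\sum_(u in D) complex.Re (F u i j)) +i* (\sum_(u in D) complex.Im (F u i j)).
  by elim/big_rec3: _ => // u x y z _ ->; case: (F u i j).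
by apply/eqP; rewrite eq_complex /= !mul0r subr0 addr0 !eqxx.
Qed.

(** The product rule over all indices gives every map the same probability, which turns expectations
    in [X] into averages over all maps. *)
Lemma with_replacement_uniform n (X : 'I_n -> Omega -> U) :
  with_replacement P X ->
  uniform_on P [set: {ffun 'I_n -> U}]%SET (fun w => [ffun k => X k w]).
Proof.
move=> [Xindep Xunif] s.
have -> : (fun w => [ffun k => X k w]) @^-1` [set s] =
    \bigcap_(k in [set` [set: 'I_n]%SET]) (X k @^-1` [set s k]).
  apply/seteqP; split=> [w /= <- k _|w Xs] /=; first by rewrite ffunE.
  by apply/ffunP => k; rewrite ffunE; apply: Xs; rewrite /= finset.in_setT.
split.
  apply: fin_bigcap_measurable => [|k _]; last exact: (Xunif k (s k)).1.
  exact: finite_finset.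
rewrite (Xindep [set: 'I_n]%SET (fun k => [set s k])) finset.in_setT.
rewrite (eq_bigr (fun=> (#|U|%:R^-1)%:E)) => [|k _].
  rewrite prodEFin prodr_const !cardsT card_ffun card_ord natrX exprVn.
  by [].
by have [_ ->] := Xunif k (s k); rewrite finset.in_setT cardsT.
Qed.

End UniformExpectation.

(** Cross terms vanish because [F] sums to zero. The factor [#|U|] on the left avoids both division
    and the exponent [n - 1]. *)
Lemma sum_ffun_sqr (V : pzRingType) (U : finType) (F : U -> V) n :
  \sum_u F u = 0 ->
  (\sum_(s : {ffun 'I_n -> U}) (\sum_i F (s i)) ^+ 2) *+ #|U| =
  (\sum_u F u ^+ 2) *+ (n * #|U| ^ n).
Proof.
move=> F0; elim: n => [|n IHn].
  by rewrite big1 ?mul0rn// => s _; rewrite big_ord0 expr0n.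
rewrite sum_fcons.
have -> : \sum_(s : {ffun 'I_n -> U}) \sum_u (\sum_i F (fcons u s i)) ^+ 2 =
   \sum_(s : {ffun 'I_n -> U}) ((\sum_i F (s i)) ^+ 2 *+ #|U| + \sum_u F u ^+ 2).
  apply: eq_bigr => s _; set S := \sum_i F (s i).
  have sq u : (\sum_i F (fcons u s i)) ^+ 2 = S ^+ 2 + F u ^+ 2 + (S * F u + F u * S).
    rewrite big_ord_recl fcons0 (eq_bigr (fun i => F (s i))) => [|i _].
      rewrite -/S !expr2 mulrDl !mulrDr [S * F u + S * S]addrC addrACA.
      by rewrite [F u * F u + _]addrC [F u * S + _]addrC.
    by rewrite fconsS.
  rewrite (eq_bigr _ (fun u _ => sq u)) !big_split /=.
  rewrite -[X in _ + (X + _)]mulr_sumr -[X in _ + (_ + X)]mulr_suml F0.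
  by rewrite mulr0 mul0r !addr0 sumr_const.
rewrite big_split /= sumrMnl IHn sumr_const card_ffun card_ord -mulrnDr -mulrnA.
by congr (_ *+ _); rewrite expnSr mulnA mulSn addnC.
Qed.

(** * Matrix moments and assembly of the bound *)

Lemma lambda_max_psd_ge0 (R : realType) (d : nat) (A : 'M[R[i]]_d) :
  (0 < d)%N -> A^t* = A -> psdmx A -> 0 <= lambda_max A.
Proof.
move=> d_gt0 Aherm Apsd.
have [U [l [i0 [Uunitary AE -> _]]]] := hermitian_lambda_max d_gt0 Aherm.
by have := Apsd (row i0 U); rewrite AE qform_diagin_row// ler0c.
Qed.

Lemma scale_sum_sqr_ffun (R : realType) (d n : nat) (U : finType) (F : U -> 'M[R[i]]_d) :
  (0 < #|U|)%N -> \sum_u F u = 0 ->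
  ((#|U|%:R ^+ n)^-1)%:C *: \sum_(s : {ffun 'I_n -> U}) (\sum_i F (s i)) ^+ 2 =
  (n%:R / #|U|%:R)%:C *: \sum_u F u ^+ 2.
Proof.
move=> U_gt0 F0; set T := \sum_s _; set Q := \sum_u _.
have N0 : #|U|%:R != 0 :> R by rewrite pnatr_eq0 -lt0n.
have scale_nat (V : 'M[R[i]]_d) m : V *+ m = (m%:R : R)%:C *: V.
  by rewrite realC_nat scaler_nat.
have := sum_ffun_sqr n F0; rewrite -/T -/Q !scale_nat natrM natrX => TQ.
have -> : T = (#|U|%:R^-1)%:C *: ((#|U|%:R : R)%:C *: T).
  by rewrite scalerA -realCM mulVf// scale1r.
rewrite TQ !scalerA -!realCM; congr (_%:C *: _).
have Nn0 : #|U|%:R ^+ n != 0 :> R by rewrite expf_neq0.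
by move: (_ ^+ n) Nn0 => x x0; field; rewrite x0 N0.
Qed.

Lemma sum_lambda_max_injective_le (R : realType) (d n : nat) (U : finType)
    (F : U -> 'M[R[i]]_d) :
  (0 < d)%N -> (0 < n)%N -> (n <= #|U|)%N -> (forall u, (F u)^t* = F u) ->
  #|U|%:R ^+ n * \sum_(t in [set t : {ffun 'I_n -> U} | injectiveb t]%SET)
    lambda_max (\sum_k F (t k)) <=
  #|[set t : {ffun 'I_n -> U} | injectiveb t]%SET|%:R *
    \sum_(s : {ffun 'I_n -> U}) lambda_max (\sum_k F (s k)).
Proof.
case: n => // n d_gt0 _ n_le Fherm.
have rot p t := lambda_max_le_rotations p t d_gt0 Fherm.
have h := @sum_injective_le _ _ _ n_le (fun h => lambda_max (\sum_k F (h k))) (rot n).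
by under eq_bigl do rewrite inE.
Qed.

Lemma matrix_bernstein_without_replacement (R : realType) (d n : nat) (U : finType)
    (F : U -> 'M[R[i]]_d) (L : R)
    (dO : measure_display) (Omega : measurableType dO) (P : probability Omega R)
    (X Y : 'I_n -> Omega -> U) :
  (0 < d)%N -> (forall u, (F u)^t* = F u) -> (forall u, lambda_max (F u) <= L) ->
  (0 < n)%N -> (n <= #|U|)%N -> with_replacement P X -> without_replacement P Y ->
  (forall k, mexpectation P (fun w => F (X k w)) = 0) ->
  let V := \sum_(k < n) mexpectation P (fun w => F (X k w) ^+ 2) in
  let v := spectral_norm (mexpectation P (fun w => (\sum_(k < n) F (X k w)) ^+ 2)) in
  [/\ v = spectral_norm V,
      v = lambda_max V &
      ('E_P[fun w => lambda_max (\sum_(k < n) F (Y k w))] <=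
        (Num.sqrt (2 * v * ln d%:R) + 3^-1 * L * ln d%:R)%:E)%E].
Proof.
move=> d_gt0 Fherm F_le n_gt0 n_le Xwith Ywithout EX0; cbv zeta; set V := \sum_(k < n) mexpectation _ _.
have U_gt0 : (0 < #|U|)%N by apply: leq_trans n_gt0 n_le.
have N_gt0 : 0 < #|U|%:R :> R by rewrite ltr0n.
have n0 : 0 < n%:R :> R by rewrite ltr0n.
have X_unif := with_replacement_uniform Xwith.
have EX k (G : U -> 'M[R[i]]_d) :
    mexpectation P (fun w => G (X k w)) = (#|U|%:R^-1)%:C *: \sum_u G u.
  rewrite (mexpectation_uniform _ (Xwith.2 k)) cardsT.
  by congr (_ *: _); apply: eq_bigl => u; rewrite finset.in_setT.
have F0 : \sum_u F u = 0.
  have /eqP := EX (Ordinal n_gt0) F; rewrite EX0 eq_sym scaler_eq0.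
  case/orP => [/eqP/complexI/eqP|/eqP//].
  by rewrite invr_eq0 gt_eqF.
have VE : V = (n%:R / #|U|%:R)%:C *: \sum_u F u ^+ 2.
  rewrite /V (eq_bigr _ (fun k _ => EX k (fun u => F u ^+ 2))).
  rewrite sumr_const card_ord scalerMnl; congr (_ *: _).
  by rewrite -mulr_natl -realC_nat -realCM.
have ES : mexpectation P (fun w => (\sum_(k < n) F (X k w)) ^+ 2) = V.
  rewrite VE -(scale_sum_sqr_ffun n U_gt0 F0).
  have := mexpectation_uniform (fun s : {ffun 'I_n -> U} => (\sum_i F (s i)) ^+ 2) X_unif.
  rewrite cardsT card_ffun card_ord natrX.
  rewrite (eq_bigl predT) => [<-|s]; last by rewrite finset.in_setT.
  congr (mexpectation P _); apply/funext => w.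
  by congr (_ ^+ 2); apply: eq_bigr => k _; rewrite ffunE.
have Vherm : V^t* = V.
  rewrite VE adjmxZ adjmx_sum conj_Creal ?complex_real//.
  by congr (_ *: _); apply: eq_bigr => u _; rewrite adjmxX Fherm.
have Vpsd : psdmx V.
  rewrite VE; apply: psdmxZ; first by rewrite ler0c divr_ge0.
  apply: psdmx_sum => u; have := psdmx_gram (F u).
  by rewrite Fherm -expr2.
rewrite ES; split=> //; first exact: spectral_norm_psd.
rewrite spectral_norm_psd//; set v := lambda_max V.
have v_ge0 : 0 <= v by exact: lambda_max_psd_ge0.
have Fv : psdmx ((#|U|%:R * (v / n%:R))%:C%:M - \sum_u F u ^+ 2).
  have w_ge0 : 0 <= (#|U|%:R / n%:R : R)%:C by rewrite ler0c divr_ge0.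
  have := psdmxZ w_ge0 (psdmx_lambda_max d_gt0 Vherm); congr psdmx.
  rewrite scalerBr scale_scalar_mx {2}VE scalerA -!realCM -/v.
  congr (_%:C%:M - _); first by rewrite mulrAC mulrA.
  rewrite (_ : _ * _ = 1) ?scale1r//.
  by field; rewrite !gt_eqF.
(* Mean zero forces this: [0 <= lambda_max 0 <= #|U| * L], as the population sums to zero. *)
have L_ge0 : 0 <= L.
  have h0 : (0 : 'M[R[i]]_d)^t* = 0 by rewrite trmx0 map_mx0.
  have psd0 : psdmx (0 : 'M[R[i]]_d) by move=> x; rewrite /qform mulmx0 mul0mx mxE.
  have := lambda_max_sum d_gt0 (a := fun=> 1) (fun _ => ler01) Fherm.
  have -> : \sum_u 1%:C *: F u = 0.
    by rewrite -scaler_sumr F0 scaler0.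
  move=> /(le_trans (lambda_max_psd_ge0 d_gt0 h0 psd0)) h.
  have : 0 <= \sum_(u : U) L.
    apply: le_trans h _; apply: ler_sum => u _; rewrite mul1r; exact: F_le.
  by rewrite sumr_const -mulr_natl pmulr_rge0.
pose lamF (t : {ffun 'I_n -> U}) := lambda_max (\sum_i F (t i)).
have YE : (fun w => lambda_max (\sum_(k < n) F (Y k w))) =
    (fun w => lamF [ffun k => Y k w]).
  apply/funext => w; rewrite /lamF; congr lambda_max.
  by apply: eq_bigr => k _; rewrite ffunE.
rewrite YE (expectation_uniform lamF Ywithout) lee_fin.
(* The average over all maps lies between: Hoeffding's comparison on one side, the Bernstein bound
   on the other. *)
apply: (@le_trans _ _ ((#|U|%:R ^+ n)^-1 *
    \sum_s lamF s)); last first.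
  rewrite ler_pdivrMl; last exact: exprn_gt0.
  exact: (finite_matrix_bernstein d_gt0 Fherm F_le F0 L_ge0 v_ge0 n_gt0 Fv U_gt0).
have D_gt0 : 0 < #|[set t : {ffun 'I_n -> U} | injectiveb t]%SET|%:R :> R.
  by rewrite ltr0n card_inj_ffuns card_ord ffact_gt0.
rewrite ler_pdivrMl; last exact: D_gt0.
rewrite mulrCA ler_pdivlMl; last exact: exprn_gt0.
exact: sum_lambda_max_injective_le.
Qed.

Theorem theorem7 (R : realType) (d n : nat) (XX : {fset 'M[R[i]]_d}) (L : R)
  (dO : measure_display) (Omega : measurableType dO) (P : probability Omega R)
  (X Y : 'I_n -> Omega -> XX)
  (d_gt0 : (0 < d)%N)
  (herm : forall A : 'M[R[i]]_d, A \in XX -> A \is hermsymmx)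
  (leL : forall A : 'M[R[i]]_d, A \in XX -> lambda_max A <= L)
  (n_gt0 : (1 <= n)%N) (n_le : (n <= #|` XX|)%N)
  (Xwith : with_replacement P X)
  (Ywithout : without_replacement P Y)
  (EX0 : forall k : 'I_n, mexpectation P (fun w => val (X k w)) = 0) :
  let SX := fun w : Omega => \sum_(k < n) val (X k w) in
  let SY := fun w : Omega => \sum_(k < n) val (Y k w) in
  let V := \sum_(k < n) mexpectation P (fun w => val (X k w) ^+ 2) in
  let v := spectral_norm (mexpectation P (fun w => SX w ^+ 2)) in
  [/\ v = spectral_norm V,
      v = lambda_max V &
      ('E_P[fun w => lambda_max (SY w)] <=
        (Num.sqrt (2 * v * ln d%:R) + 3^-1 * L * ln d%:R)%:E)%E].
Proof.
apply: (matrix_bernstein_without_replacement (F := val)) => //.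
- by move=> A; apply: hermsymmxE; apply: herm; exact: valP.
- by move=> A; apply: leL; exact: valP.
- by rewrite cardfE in n_le.
Qed.
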